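(* Let $P \colon \mathbb{R}^n \to \mathbb{R}$ be a non-constant polynomial with real coefficients such that the algebraic surface $S(P) = \{x \in \mathbb{R}^n : P(x) = 0\}$ is compact. Then there is no non-trivial self-affine set $E \subset \mathbb{R}^n$ with $E \subset S(P)$.
   Context: A map $f \colon \mathbb{R}^n \to \mathbb{R}^n$ is affine if $f(x) = Tx + v$ for all $x\in\mathbb{R}^n$, where $T$ is an $n \times n$ real matrix (the linear part) and $v \in \mathbb{R}^n$; it is invertible iff $T$ is non-singular. A map $f \colon \mathbb{R}^n \to \mathbb{R}^n$ is strictly contractive if $|f(x)-f(y)| < |x-y|$ for all distinct $x,y \in \mathbb{R}^n$ (Euclidean norm); an affine map is strictly contractive iff its linear part has operator norm $\|T\|<1$. An affine iterated function system (IFS) is a finite collection $\{f_i\}_{i=1}^\ell$ of strictly contractive invertible affine maps $f_i \colon \mathbb{R}^n \to \mathbb{R}^n$. A non-empty compact set $E \subset \mathbb{R}^n$ is self-affine if $E = \bigcup_{i=1}^\ell f_i(E)$ for some affine IFS $\{f_i\}_{i=1}^\ell$. A self-affine set is non-trivial if it is not a singleton. *)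

(* Defs.v *)
From HB Require Import structures.
From mathcomp Require Import all_boot all_order all_algebra.
(* Not imported: the notations of [mpoly] clash with those of MathComp-Analysis. *)
From mathcomp Require mpoly.
From mathcomp Require Import all_classical all_reals all_analysis.

Set Implicit Arguments.
Unset Strict Implicit.
Unset Printing Implicit Defensive.

Import Order.TTheory GRing.Theory Num.Theory.
Import numFieldNormedType.Exports.

Local Open Scope classical_set_scope.
Local Open Scope ring_scope.

(* The library norm on matrices is the sup norm, hence this definition. Only
   the topology on ['cV[R]_n] (the product topology, used by [compact] below)
   is taken from the library; the Euclidean norm induces the same one. *)
Definition enorm (R : realType) (n : nat) (x : 'cV[R]_n) : R :=
  Num.sqrt (\sum_(i < n) x i ord0 ^+ 2).

Definition affine_map (R : realType) (n : nat) (f : 'cV[R]_n -> 'cV[R]_n) :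
    Prop :=
  exists (T : 'M[R]_n) (v : 'cV[R]_n), forall x, f x = T *m x + v.

Definition strictly_contractive (R : realType) (n : nat)
    (f : 'cV[R]_n -> 'cV[R]_n) : Prop :=
  forall x y, x <> y -> enorm (f x - f y) < enorm (x - y).

(* Invertibility is that of the map; for an affine map it amounts to
   non-singularity of the linear part. *)
Definition affine_ifs (R : realType) (n l : nat)
    (f : 'I_l -> 'cV[R]_n -> 'cV[R]_n) : Prop :=
  forall i, [/\ affine_map (f i), bijective (f i)
              & strictly_contractive (f i)].

Definition self_affine (R : realType) (n : nat) (E : set 'cV[R]_n) : Prop :=
  [/\ E !=set0, compact E &
      exists (l : nat) (f : 'I_l -> 'cV[R]_n -> 'cV[R]_n),
        affine_ifs f /\ E = \bigcup_(i in [set: 'I_l]) (f i @` E)].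

Definition nontrivial (R : realType) (n : nat) (E : set 'cV[R]_n) : Prop :=
  ~ exists x, E = [set x].

Definition nonconstant (R : realType) (n : nat) (P : mpoly.mpoly n R) : Prop :=
  ~ exists c : R, P = mpoly.mpolyC n c.

Definition zero_surface (R : realType) (n : nat) (P : mpoly.mpoly n R) :
    set 'cV[R]_n :=
  [set x | mpoly.meval (fun i => x i ord0) P = 0].

(* Main.v *)
Require Import Defs.
From HB Require Import structures.
From mathcomp Require Import all_boot all_order all_algebra.
From mathcomp Require mpoly.
From mathcomp Require Import all_classical all_reals all_analysis.
Import numFieldNormedType.Exports.
Import Order.TTheory GRing.Theory Num.Theory.
Local Open Scope classical_set_scope.
Local Open Scope ring_scope.
Import -(notations) mpoly.

(** Only one map [f] of the system is used: [f] is affine, bijective and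
    strictly contractive, and [f @` E `<=` E].

    All the pullbacks [P \o f^k] are polynomials of degree at most [deg P]
    ([affine_pullback]), so they satisfy a nontrivial linear relation
    ([linear_relation]).  Let [Z] be the set of points whose forward orbit
    under [f] stays in the surface; it lies between [E] and the surface.
    If [c_i] is the first nonzero coefficient of the relation, evaluating the
    relation at [f^-(i+1) x] with [x \in Z] kills every later term, since those
    are values of [P] on the forward orbit of [x]; what is left is
    [P (f^-1 x) = 0].  Hence [Z] is also stable under [f^-1]
    ([invariant_zeros_backward]): a polynomial identity lets one run the
    dynamics backwards.

    Now [Z] is a closed part of a compact surface, hence compact, while [f^-1]
    strictly increases distances.  A pair of points of [Z] at maximal distance
    would be spread further apart by [f^-1] unless its points coincide, so [Z]
    has at most one point ([expanding_compact_eq]), and so has [E]. *)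

Local Notation msize p := (@mmeasure _ _ mdeg p).

(** * Pullbacks of polynomials by affine maps *)

Lemma msize_mul_le {R : idomainType} {n} (p q : mpoly n R) a b :
  (msize p <= a.+1)%N -> (msize q <= b.+1)%N -> (msize (p * q) <= (a + b).+1)%N.
Proof.
have [->|p0] := eqVneq p 0; first by rewrite mul0r msize0.
have [->|q0] := eqVneq q 0; first by rewrite mulr0 msize0.
move=> pa qb; rewrite msizeM // -subn1 leq_subLR add1n -addSn -addnS.
exact: leq_add.
Qed.

Lemma msize_exp_le {R : idomainType} {n} (p : mpoly n R) k :
  (msize p <= 2)%N -> (msize (p ^+ k) <= k.+1)%N.
Proof.
move=> p2; elim: k => [|k IHk]; first by rewrite expr0 msize1.
by rewrite exprS -add1n; apply: (@msize_mul_le _ _ _ _ 1 k).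
Qed.

(** Each monomial of degree [d] becomes a product of [d] polynomials of degree
    at most one, so substitution cannot raise the degree. *)
Lemma msize_comp_le {R : idomainType} {n k} (lq : n.-tuple (mpoly k R))
    (p : mpoly n R) :
  (forall i, (msize (tnth lq i) <= 2)%N) -> (msize (comp_mpoly lq p) <= msize p)%N.
Proof.
move=> lq2; rewrite comp_mpolyE (leq_trans (msize_sum _ _ _)) //.
apply/bigmax_leqP_seq => m mp _.
apply: leq_trans (msizeZ_le _ _) _; apply: leq_trans (msize_mdeg_lt mp).
rewrite mdegE; apply: (big_ind2 (fun q d => (msize q <= d.+1)%N)).
- by rewrite msize1.
- by move=> q a r b; exact: msize_mul_le.
- by move=> i _; exact: msize_exp_le.
Qed.

(** There are finitely many multinomials of degree less than [d]; the matrix of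
    coefficients of [u 0, u 1, ...] with one more row than columns has a
    nonzero kernel. *)
Lemma linear_relation {R : fieldType} {n d} (u : nat -> mpoly n R) :
  (forall j, (msize (u j) <= d)%N) ->
  exists N (c : 'I_N -> R),
    (exists i, c i != 0) /\ \sum_(i < N) c i *: u i = 0.
Proof.
move=> ud; pose B := bmultinom n d.
pose A := \matrix_(i < #|{: B}|.+1, j < #|{: B}|) mcoeff (enum_val j : B) (u i).
have /rowV0Pn[c /sub_kermxP cA /rV0Pn c0] : kermx A != 0.
  by rewrite -mxrank_eq0 mxrank_ker subn_eq0 -ltnNge ltnS rank_leq_col.
exists #|{: B}|.+1, (c 0); split => //.
apply/mpolyP => m; rewrite mcoeff0 raddf_sum /=.
have [md|dm] := ltnP (mdeg m) d; last first.
  rewrite big1 // => i _; rewrite mcoeffZ memN_msupp_eq0 ?mulr0 //.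
  by apply/msize_mdeg_ge/(leq_trans (ud i)).
have /rowP/(_ (enum_rank (BMultinom md : B))) := cA.
rewrite !mxE => cm; rewrite -[RHS]cm; apply: eq_bigr => i _.
by rewrite mcoeffZ mxE enum_rankK.
Qed.

Definition coords {R : realType} {n} (x : 'cV[R]_n) : 'I_n -> R :=
  fun i => x i ord0.

Lemma affine_pullback {R : realType} {n} {f : 'cV[R]_n -> 'cV[R]_n}
    (P : mpoly n R) : affine_map f ->
  exists2 Q : mpoly n R, (msize Q <= msize P)%N
    & forall x, meval (coords x) Q = meval (coords (f x)) P.
Proof.
move=> [T [v fE]].
pose l i : mpoly n R := \sum_j T i j *: mpolyX R (mnm1 j) + mpolyC n (v i ord0).
exists (comp_mpoly [tuple l i | i < n] P).
  apply: msize_comp_le => i; rewrite tnth_mktuple.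
  apply: leq_trans (msizeD_le _ _) _; rewrite geq_max msizeC; apply/andP; split.
    apply: leq_trans (msize_sum _ _ _) _; apply/bigmax_leqP => j _.
    by apply: leq_trans (msizeZ_le _ _) _; rewrite msizeX mdeg1.
  by case: (_ != 0).
move=> x; rewrite comp_mpoly_meval; apply: meval_eq => i.
rewrite tnth_mktuple mevalD mevalC raddf_sum /= /coords fE !mxE; congr (_ + _).
by apply: eq_bigr => j _; rewrite mevalZ mevalXU.
Qed.

(** * Running the dynamics backwards *)

(** The largest part of the surface that [f] maps into itself. *)
Definition invariant_zeros {R : realType} {n} (P : mpoly n R)
    (f : 'cV[R]_n -> 'cV[R]_n) : set 'cV[R]_n :=
  \bigcap_(k in setT) (iter k f @^-1` zero_surface P).

(** The first nonzero term of a linear relation between the [P \o f^k]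
    expresses [P \o f^i] through the [P \o f^j] with [j > i]; composing with
    [g^i], [P] itself is a combination of the [P \o f^j] with [j > 0], so that
    vanishing of [P] propagates from a forward orbit to the preceding point. *)
Lemma invariant_zeros_backward {R : realType} {n} (P : mpoly n R)
    {f g : 'cV[R]_n -> 'cV[R]_n} :
  affine_map f -> cancel g f ->
  forall x, invariant_zeros P f x -> invariant_zeros P f (g x).
Proof.
move=> faff gK x xZ.
have /choice[u uP] k : exists Q : mpoly n R, (msize Q <= msize P)%N /\
    forall y, meval (coords y) Q = meval (coords (iter k f y)) P.
  elim: k => [|k [Q [QP QE]]]; first by exists P.
  have [Q' Q'Q Q'E] := affine_pullback Q faff.
  exists Q'; split=> [|y]; first exact: leq_trans Q'Q QP.
  by rewrite Q'E QE -iterSr.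
have [N [c [[i0 ci0] rel]]] := linear_relation u (fun k => (uP k).1).
have [i ci imin] := @arg_minnP _ i0 (fun i => c i != 0) (fun i => i : nat) ci0.
(* The relation is evaluated at [g^(i+1) x]: exponent [i] lands on [g x], and
   exponent [j > i] on the point [f^(j-i-1) x]. *)
have fg k m y : iter (k + m) f (iter k g y) = iter m f y.
  elim: k => [//|k IHk] in y *.
  by rewrite addSn iterSr /= gK IHk.
suff Pgx : meval (coords (g x)) P = 0.
  by case=> [_|k _]; [exact: Pgx|rewrite /= -iterS iterSr gK; exact: xZ].
have := congr1 (meval (coords (iter i.+1 g x))) rel.
set y := iter i.+1 g x.
rewrite raddf_sum meval0 (bigD1 i) //= big1 => [|j ji].
  rewrite addr0 mevalZ (uP i).2 /y iterSr -[X in iter X f]addn0 fg /=.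
  by move/eqP; rewrite mulf_eq0 (negPf ci) => /eqP.
rewrite mevalZ (uP j).2.
have [->|cj] := eqVneq (c j) 0; first by rewrite mul0r.
have ij : (i < j)%N by rewrite ltn_neqAle eq_sym ji imin.
by rewrite /y -(subnKC ij) fg xZ ?mulr0.
Qed.

(** * Continuity *)

Lemma sum_continuous {R : realType} {T : topologicalType} {m}
    {F : 'I_m -> T -> R} :
  (forall i, continuous (F i)) -> continuous (fun x => \sum_i F i x).
Proof.
by move=> Fc; apply: continuous_big => [|i _]; [exact: add_continuous|exact: Fc].
Qed.

Lemma affine_continuous {R : realType} {n} {f : 'cV[R]_n -> 'cV[R]_n} :
  affine_map f -> continuous f.
Proof.
move=> [T [v fE]].
have fc i j : continuous (fun y : 'cV[R]_n => f y i j).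
  have -> : (fun y => f y i j) = (fun y : 'cV[R]_n => \sum_k T i k * y k j + v i j).
    by apply/funext => y; rewrite fE !mxE.
  move=> y; apply: continuousD; last exact: cst_continuous.
  apply: sum_continuous => k {}y.
  by apply: continuousM; [exact: cst_continuous|exact: coord_continuous].
move=> x A [B fxB BA].
have fB : nbhs x [set y | forall i j, B i j (f y i j)].
  have coordB i j : nbhs x [set y | B i j (f y i j)] := fc i j x _ (fxB i j).
  apply: (@filter_forall _ _ (fun i y => forall j, B i j (f y i j)) _
    (nbhs_filter x)) => i.
  exact: (@filter_forall _ _ (fun j y => B i j (f y i j)) _ (nbhs_filter x) (coordB i)).
have sB : [set y | forall i j, B i j (f y i j)] `<=` f @^-1` A.
  by move=> y By; exact: BA.
exact: filterS sB fB.
Qed.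

Lemma iter_continuous {T : topologicalType} {f : T -> T} {k} :
  continuous f -> continuous (iter k f).
Proof.
move=> fc; elim: k => [|k IHk]; first by move=> x A.
rewrite (_ : iter k.+1 f = f \o iter k f) // => x.
by apply: continuous_comp; [exact: IHk|exact: fc].
Qed.

Lemma enorm0 {R : realType} {n} : enorm (0 : 'cV[R]_n) = 0.
Proof. by rewrite /enorm big1 ?sqrtr0 // => i _; rewrite mxE expr0n. Qed.

Lemma enorm_sub_continuous {R : realType} {n} :
  continuous (fun xy : 'cV[R]_n * 'cV[R]_n => enorm (xy.1 - xy.2)).
Proof.
move=> xy; apply: (@continuous_comp _ _ _ _ Num.sqrt); last exact: sqrt_continuous.
apply: sum_continuous => i {}xy.
pose h (z : 'cV[R]_n * 'cV[R]_n) := z.1 i ord0 - z.2 i ord0.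
have -> : (fun z : 'cV[R]_n * 'cV[R]_n => (z.1 - z.2) i ord0 ^+ 2) = (fun z => h z * h z).
  by apply/funext => z; rewrite !mxE expr2.
suff hc : {for xy, continuous h} by exact: continuousM.
apply: continuousB.
- by apply: (@continuous_comp _ 'cV[R]_n R fst (fun u => u i ord0));
    [exact: cvg_fst|exact: coord_continuous].
- by apply: (@continuous_comp _ 'cV[R]_n R snd (fun u => u i ord0));
    [exact: cvg_snd|exact: coord_continuous].
Qed.

(** * Compactness against expansion *)

(** A pair of points of [K] at maximal distance exists by compactness; were its
    points distinct, [g] would take it to a pair of points of [K] at a strictly
    larger distance.  Working with a maximal pair avoids deriving a uniform
    contraction ratio for [f]. *)
Lemma expanding_compact_eq {R : realType} {n} {K : set 'cV[R]_n}
    {f g : 'cV[R]_n -> 'cV[R]_n} :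
  compact K -> strictly_contractive f -> cancel g f ->
  (forall x, K x -> K (g x)) -> forall x y, K x -> K y -> x = y.
Proof.
move=> cK fc gK Kg x y Kx Ky.
have KK0 : K `*` K !=set0 by exists (x, y).
have [[a b] /set_mem[/= Ka Kb] ab_max] := compact_EVT_max KK0 (compact_setX cK cK)
  (continuous_subspaceT enorm_sub_continuous).
(* Even an arbitrary pair of distinct points is strictly closer than [a], [b],
   because its image under [g] is not farther apart than they are. *)
have expand u v : K u -> K v -> u != v -> enorm (u - v) < enorm (a - b).
  move=> Ku Kv /eqP uv; have guv : g u <> g v.
    by move=> /(congr1 f); rewrite !gK.
  have := fc _ _ guv; rewrite !gK => /lt_le_trans; apply.
  exact: (ab_max (g u, g v) (mem_set (conj (Kg _ Ku) (Kg _ Kv)))).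
have /eqP ab : a == b.
  by apply: contraT => ab; have := expand a b Ka Kb ab; rewrite ltxx.
apply/eqP; apply: contraT => xy; have := expand x y Kx Ky xy.
by rewrite ab subrr enorm0 ltNge sqrtr_ge0.
Qed.

Theorem theorem2 (R : realType) (n : nat) (P : mpoly.mpoly n R)
    (hP : nonconstant P) (hc : compact (zero_surface P)) :
  ~ exists E : set 'cV[R]_n,
      [/\ self_affine E, nontrivial E & E `<=` zero_surface P].
Proof.
case=> E [[[e Ee] _ [l [f [ifs EE]]]] ntE ES].
have [i _] : (\bigcup_(i in [set: 'I_l]) (f i @` E)) e by rewrite -EE.
move=> _; have [faff [g _ gK] fcontr] := ifs i.
have fE x : E x -> E (f i x) by move=> Ex; rewrite EE; exists i => //; exists x.
have EZ x : E x -> invariant_zeros P (f i) x.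
  by move=> Ex k _; apply: ES; elim: k => //= k; exact: fE.
have cZ : compact (invariant_zeros P (f i)).
  apply: (subclosed_compact _ hc); last by move=> x /(_ 0%N I).
  apply: closed_bigI => k _; apply: preimage_closed; last first.
    by apply: compact_closed hc; exact: norm_hausdorff.
  by move=> x _; exact: iter_continuous (affine_continuous faff) x.
apply: ntE; exists e; apply/seteqP; split=> [x Ex|_ -> //].
apply: (expanding_compact_eq cZ fcontr gK); [|exact: EZ..].
exact: invariant_zeros_backward.
Qed.
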